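(* Let $K$ be a non-archimedean local field with normalized valuation $v$ and absolute value $|x|=q^{-v(x)}$, where $q$ is the cardinality of the residue field. Let $V$ be an $n$-dimensional $K$-vector space with a fixed basis $v_1,\dots,v_n$, put $\underline{n}=\{1,\dots,n\}$, let $G=PGL(V)$, let $T\subset G$ be the image of the invertible diagonal matrices (with respect to $v_1,\dots,v_n$), and let $N$ be the normalizer of $T$ in $G$. Let $\overline{A}=\bigcup_{\emptyset\neq I\subseteq \underline{n}} A_I$ be the compactified apartment with its topology and its $N$-action $\nu$ described in the context. Then: (i) the topological space $\overline{A}$ is compact and contractible, and $A=A_{\underline{n}}$ is an open, dense subset of $\overline{A}$; (ii) the action $\nu: N\times\overline{A}\to\overline{A}$ is continuous (where $N$ carries the topology induced from $G=PGL_n(K)$).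
   Context: ''$\subset$'' means strict inclusion, ''$\subseteq$'' allows equality. For each nonempty $I\subseteq\underline{n}$ let $A_I$ be the real vector space generated by symbols $\overline{\eta}^I_i$ ($i\in I$) subject to the single relation $\sum_{i\in I}\overline{\eta}^I_i=0$ (so $A_I$ has dimension $|I|-1$). Put $A=A_{\underline{n}}$ and $\eta_i=\overline{\eta}^{\underline{n}}_i$. For nonempty $I\subseteq\underline{n}$ let $s_I:A\to A_I$ be the linear surjection with $s_I(\eta_i)=\overline{\eta}^I_i$ if $i\in I$ and $s_I(\eta_i)=0$ if $i\notin I$ ($s_{\underline n}$ is the identity). Let $\overline{A}$ be the disjoint union of all $A_I$, $\emptyset\neq I\subseteq\underline{n}$. Action: $N=T\rtimes W$, where $W$ is the group of permutation matrices, identified with permutations $w$ of $\underline{n}$ via $w(v_i)=v_{w(i)}$. An element $t\in T$ induced by the diagonal matrix with entries $d_1,\dots,d_n$ acts on each $A_I$ by translation by $\sum_{i\in I}-v(d_i)\overline{\eta}^I_i$. An element $w\in W$ acts by the linear maps $A_I\to A_{w(I)}$, $\overline{\eta}^I_i\mapsto \overline{\eta}^{w(I)}_{w(i)}$. Together these give an action $\nu$ of $N$ on $\overline{A}$. Topology: for nonempty $I\subset\underline{n}$ put $\Delta_I=\sum_{i\notin I}\mathbb{R}_{\geq 0}\eta_i\subset A$, and for an open bounded subset $U\subset A$ put $\Gamma^I_U=(U+\Delta_I)\cup\bigcup_{I\subseteq J\subset\underline{n}} s_J(U+\Delta_I)$. The topology on $\overline{A}$ is the one having as a base the open subsets of $A$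 (usual Euclidean topology) together with all sets $\Gamma^I_U$ for nonempty $I\subset\underline{n}$ and open bounded $U\subset A$. *)

(* Defs.v *)
From HB Require Import structures.
From mathcomp Require Import all_boot all_order all_algebra generic_quotient.
From mathcomp Require Import all_classical all_reals.
From mathcomp Require Import fingroup perm topology normedtype.
Import numFieldTopology.Exports numFieldNormedType.Exports.
Set Implicit Arguments. Unset Strict Implicit. Unset Printing Implicit Defensive.
Import Order.TTheory GRing.Theory Num.Theory.
Local Open Scope ring_scope.
Local Open Scope quotient_scope.
Local Open Scope classical_set_scope.

(* 1. The field K: a field with a (normalized, discrete) valuation
      v : K -> int (the value v 0 is irrelevant and unconstrained).         *)

(* "v(x - y) >= m", with the convention v(0) = +oo *)
Definition vclose (K : fieldType) (v : K -> int) (m : int) (x y : K) : Prop :=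
  x - y = 0 \/ m <= v (x - y).

(* K is a non-archimedean local field with normalized valuation v:
   v is a discrete valuation, normalized (surjective onto Z, i.e. some
   uniformizer has valuation 1), K is complete for it, and the residue
   field O/m is finite (given by a finite list of representatives in O). *)
Definition nonarch_local_field (K : fieldType) (v : K -> int) : Prop :=
  [/\ (forall x y : K, x != 0 -> y != 0 -> v (x * y) = v x + v y),
      (forall x y : K, x != 0 -> y != 0 -> x + y != 0 ->
          Order.min (v x) (v y) <= v (x + y)),
      (exists pi : K, pi != 0 /\ v pi = 1),
      (exists s : seq K, (forall r, r \in s -> r = 0 \/ 0 <= v r) /\
          (forall x : K, x != 0 -> 0 <= v x ->
             exists2 r, r \in s & vclose v 1 x r))
    & (forall u : nat -> K,
         (forall m : int, exists N : nat, forall i j : nat,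
             (N <= i)%N -> (N <= j)%N -> vclose v m (u i) (u j)) ->
         exists l : K, forall m : int, exists N : nat, forall i : nat,
             (N <= i)%N -> vclose v m (u i) l)].

Definition Kv (K : fieldType) (v : K -> int) : Type := K.
Section KTopology.
Variables (K : fieldType) (v : K -> int).
HB.instance Definition _ := Choice.on (Kv v).
Definition Kv_open (U : set (Kv v)) : Prop :=
  forall x, U x -> exists m : int, forall y : K, vclose v m y x -> U y.
Lemma Kv_openT : Kv_open setT. Proof. by move=> x _; exists 0. Qed.
Lemma Kv_openI : setI_closed Kv_open.
Proof.
move=> A B oA oB x [Ax Bx].
have [m1 h1] := oA x Ax; have [m2 h2] := oB x Bx.
exists (Order.max m1 m2) => y [e|le]; split.
- by apply: h1; left.
- by apply: h2; left.
- by apply: h1; right; apply: le_trans le; rewrite le_max lexx.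
- by apply: h2; right; apply: le_trans le; rewrite le_max lexx orbT.
Qed.
Lemma Kv_open_bigU (I : Type) (f : I -> set (Kv v)) :
  (forall i, Kv_open (f i)) -> Kv_open (\bigcup_i f i).
Proof.
move=> oF x [i _ Fix]; have [m hm] := oF i x Fix.
by exists m => y /hm fy; exists i.
Qed.
HB.instance Definition _ :=
  isOpenTopological.Build (Kv v) Kv_openT Kv_openI Kv_open_bigU.
End KTopology.

(* 2. G = PGL_n(K) with the quotient topology of GL_n(K), GL_n(K) carrying
      the subspace topology of M_n(K) = K^(n x n); N = T.W inside G.        *)
Section PGL.
Variables (K : fieldType) (v : K -> int) (n : nat).

Definition mxK (M : 'M[Kv v]_n) : 'M[K]_n := M.
Definition GLset : set 'M[Kv v]_n := [set M | mxK M \in unitmx].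
Definition GLn : Type := set_type GLset.

Definition scal_rel (A B : GLn) : bool :=
  `[< exists c : K, c != 0 /\ mxK (set_val B) = c *: mxK (set_val A) >].

Lemma scal_refl : reflexive scal_rel.
Proof. by move=> A; apply/asboolP; exists 1; rewrite oner_eq0 scale1r. Qed.
Lemma scal_sym : symmetric scal_rel.
Proof.
have H (A B : GLn) : scal_rel A B -> scal_rel B A.
  move=> /asboolP[c [c0 e]]; apply/asboolP; exists c^-1.
  by rewrite invr_eq0 c0 e scalerA mulVf // scale1r.
by move=> A B; apply/idP/idP; apply: H.
Qed.
Lemma scal_trans : transitive scal_rel.
Proof.
move=> B A C /asboolP[c [c0 e1]] /asboolP[d [d0 e2]]; apply/asboolP.
by exists (d * c); rewrite mulf_neq0 // e2 e1 scalerA.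
Qed.
Canonical scal_equiv := EquivRel scal_rel scal_refl scal_sym scal_trans.

Definition PGLn : Type := quotient_topology {eq_quot scal_rel}.

Definition TW_mx (M : 'M[K]_n) : Prop :=
  exists (d : 'I_n -> K) (s : 'S_n),
    (forall i, d i != 0) /\ M = diag_mx (\row_i d i) *m perm_mx s.

Definition Nset : set PGLn :=
  [set g | exists M : GLn, \pi_PGLn M = g /\ TW_mx (mxK (set_val M))].
Definition Nn : Type := set_type Nset.

Definition Nmx (g : Nn) : 'M[K]_n := mxK (set_val (generic_quotient.repr (set_val g))).
End PGL.

(* 3. The compactified apartment.  A point of A_I is represented by its
      unique coordinate vector x (x = sum_i x_i eta^I_i) normalized by
      x_i = 0 for i \notin I and sum_{i in I} x_i = 0.                        *)
Section Apartment.
Variables (R : realType) (n : nat).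

Definition abar_ok (p : {set 'I_n} * 'rV[R]_n) : bool :=
  [&& p.1 != finset.set0, [forall i, (i \notin p.1) ==> (p.2 0 i == 0)]
    & \sum_(i in p.1) p.2 0 i == 0].

Definition Abar0 : Type := {p : {set 'I_n} * 'rV[R]_n | abar_ok p}.
HB.instance Definition _ := Choice.on Abar0.

Definition abI (p : Abar0) : {set 'I_n} := (val p).1.
Definition coord (p : Abar0) : 'rV[R]_n := (val p).2.

(* the normalized coordinates of sum_{i in I} y_i eta^I_i ;
   normI I is the coordinate expression of s_I (and of the projection
   from the free vector space on I to A_I) *)
Definition normI (I : {set 'I_n}) (y : 'rV[R]_n) : 'rV[R]_n :=
  \row_i (if i \in I then y 0 i - (\sum_(j in I) y 0 j) / #|I|%:R else 0).

Definition Aset : set Abar0 := [set p | abI p = finset.setT].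

Definition openA (U : set Abar0) : Prop :=
  U `<=` Aset /\
  exists O : set 'rV[R]_n, open O /\ U = Aset `&` (coord @^-1` O).

Definition boundedA (U : set Abar0) : Prop :=
  exists M : R, forall p, U p -> forall i, `|coord p 0 i| <= M.

Definition UDelta (I : {set 'I_n}) (U : set Abar0) : set 'rV[R]_n :=
  [set a | exists2 p, U p & exists t : 'rV[R]_n,
     [/\ forall i, 0 <= t 0 i, forall i, i \in I -> t 0 i = 0
       & a = coord p + normI finset.setT t]].

Definition Gamma (I : {set 'I_n}) (U : set Abar0) : set Abar0 :=
  [set p | (Aset p /\ UDelta I U (coord p)) \/
     exists J : {set 'I_n}, [/\ I \subset J, J \proper finset.setT, abI p = J
       & exists2 a, UDelta I U a & coord p = normI J a]].

Definition Abar_base (W : set Abar0) : Prop :=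
  openA W \/
  exists (I : {set 'I_n}) (U : set Abar0),
    [/\ I != finset.set0, I \proper finset.setT, openA U, boundedA U & W = Gamma I U].

Definition Abar : Type := Abar0.
HB.instance Definition _ := Choice.on Abar.
(* the topology generated by Abar_base (which is a base of it) *)
HB.instance Definition _ :=
  isSubBaseTopological.Build Abar Abar_base (fun W : set Abar => W).
End Apartment.

(* 4. The action nu of N on \overline A.  For M = diag(d) * perm matrix,
      row j of M has a single nonzero entry, in column col_of M j; the
      element acts by  A_I -> A_{I'},  I' = {j | col_of M j \in I},
      eta^I_{col j} |-> eta^{I'}_j, followed by translation by
      sum_{j in I'} -v(M_{j, col j}) eta^{I'}_j.                            *)
Section Action.
Variables (R : realType) (K : fieldType) (v : K -> int) (n : nat).

Definition col_of (M : 'M[K]_n) (j : 'I_n) : 'I_n :=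
  odflt j [pick k | M j k != 0].

Definition nu_mx (M : 'M[K]_n) (p : Abar R n) : Abar R n :=
  let I' := finset.finset (fun j => col_of M j \in abI p) in
  let y := \row_j (coord p 0 (col_of M j) - (v (M j (col_of M j)))%:~R) in
  odflt p (insub (I', normI I' y)).

Definition nu (g : Nn v n) (p : Abar R n) : Abar R n := nu_mx (Nmx g) p.
End Action.

Definition contractible (R : realType) (X : topologicalType) : Prop :=
  exists (c : X) (H : set_type (`[(0 : R), 1] : set R) * X -> X),
    [/\ continuous H,
        forall t x, set_val t = 0 -> H (t, x) = x
      & forall t x, set_val t = 1 -> H (t, x) = c].

(* Main.v *)
Require Import Defs.
From HB Require Import structures.
From mathcomp Require Import all_boot all_order all_algebra generic_quotient.
From mathcomp Require Import all_classical all_reals.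
From mathcomp Require Import fingroup perm topology normedtype.
From mathcomp Require Import sequences exp zify ring lra.
Import numFieldTopology.Exports numFieldNormedType.Exports.
Import Order.TTheory GRing.Theory Num.Theory.
Local Open Scope ring_scope.
Local Open Scope classical_set_scope.

(* Sending sum_i x_i eta^I_i to (exp (- x_i))_i, extended by zero outside I, and
   rescaling identifies the compactified apartment with the standard simplex; A
   corresponds to its interior and A_I to the open face with vertex set I. In these
   coordinates Gamma^I_U is the set of z such that z_i = w_i for i in I and z_j <= w_j
   for j outside I, for some w in the open cone over U, which makes both directions of
   the identification continuous. Compactness, contractibility (the simplex is convex)
   and density follow. A monomial matrix acts on the simplex by permuting and rescaling
   the coordinates, hence continuously, and only through its permutation and the
   valuations of its nonzero entries up to a common constant; since v is locally
   constant on nonzero elements, g |-> nu g is locally constant on N. *)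

Set Implicit Arguments.
Unset Strict Implicit.
Unset Printing Implicit Defensive.

(* [coord] would otherwise refer to the coordinates of the vector library. *)
Local Notation coord := Defs.coord.

(** * Homogeneous coordinates and the sets Gamma *)

Section Coordinates.
Variables (R : realType) (n : nat).
Implicit Types (I J : {set 'I_n}) (x y z : 'rV[R]_n) (p q : Abar R n).

Lemma normI_ok I y : I != finset.set0 -> abar_ok (I, normI I y).
Proof.
move=> I0; apply/and3P; split => //=.
  by apply/forallP => i; apply/implyP => iI; rewrite mxE (negbTE iI).
under eq_bigr => i iI do rewrite mxE iI.
rewrite sumrB sumr_const -[_ / _ *+ _]mulr_natr divfK ?subrr //.
by rewrite pnatr_eq0 -lt0n card_gt0.
Qed.

(** A constant vector on I is a multiple of the defining relation of A_I. With the converse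
    [normI_eqP], the fibres of [normI I] are, on I, the classes modulo constants. *)
Lemma normI_shift I x y (c : R) : I != finset.set0 ->
  (forall i, i \in I -> x 0 i = y 0 i + c) -> normI I x = normI I y.
Proof.
move=> I0 xy; apply/rowP => i; rewrite !mxE; case: ifP => // iI.
rewrite (eq_bigr _ xy) big_split /= sumr_const -[c *+ _]mulr_natr mulrDl xy //.
rewrite mulfK; first by ring.
by rewrite pnatr_eq0 -lt0n card_gt0.
Qed.

Lemma normI_eqP I x y : normI I x = normI I y ->
  exists c : R, forall i, i \in I -> x 0 i = y 0 i + c.
Proof.
move=> e; exists ((\sum_(j in I) x 0 j - \sum_(j in I) y 0 j) / #|I|%:R) => i iI.
have /rowP/(_ i) := e; rewrite !mxE iI mulrBl => h; lra.
Qed.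

Lemma abI_neq0 p : abI p != finset.set0.
Proof. by have /and3P[] := valP p. Qed.

Lemma coord_out p i : i \notin abI p -> coord p 0 i = 0.
Proof. by have /and3P[_ /forallP/(_ i)/implyP h _] := valP p; move=> /h/eqP. Qed.

Lemma coord_sum p : \sum_(i in abI p) coord p 0 i = 0.
Proof. by have /and3P[_ _ /eqP] := valP p. Qed.

Lemma normI_coord p : normI (abI p) (coord p) = coord p.
Proof.
apply/rowP => i; rewrite mxE coord_sum mul0r subr0.
by case: ifPn => // /coord_out.
Qed.

Lemma abar_eq p q : abI p = abI q -> coord p = coord q -> p = q.
Proof.
move=> eI ec; apply: val_inj; rewrite [LHS]surjective_pairing.
by rewrite [RHS]surjective_pairing; congr pair.
Qed.

(* Homogeneous coordinates: the point sum_i x_i eta^I_i of A_I corresponds to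
   the class of (exp (- x_i))_i, extended by zero outside I. *)
Definition cone : set 'rV[R]_n :=
  [set z | (forall i, 0 <= z 0 i) /\ exists i, 0 < z 0 i].

Definition supp z : {set 'I_n} := finset.finset (fun i => 0 < z 0 i).

Lemma supp_neq0 z : cone z -> supp z != finset.set0.
Proof. by move=> [_ [i zi]]; apply/finset.set0Pn; exists i; rewrite finset.inE. Qed.

Definition mlog z : 'rV[R]_n := \row_i (- ln (z 0 i)).

Definition mkpt I y (I0 : I != finset.set0) : Abar R n :=
  exist _ (I, normI I y) (normI_ok y I0).

(** The default [p0] is returned only when z has no positive coordinate. Values of [ln] at
    nonpositive arguments are discarded by [normI (supp z)]. *)
Definition point_of_cone p0 z : Abar R n :=
  insubd p0 (supp z, normI (supp z) (mlog z)).

Lemma point_of_coneE p0 z (hz : cone z) :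
  point_of_cone p0 z = mkpt (mlog z) (supp_neq0 hz).
Proof.
apply: val_inj; rewrite /point_of_cone val_insubd /=.
by rewrite normI_ok // supp_neq0.
Qed.

Lemma abI_point p0 z : cone z -> abI (point_of_cone p0 z) = supp z.
Proof. by move=> hz; rewrite point_of_coneE. Qed.

Lemma coord_point p0 z : cone z ->
  coord (point_of_cone p0 z) = normI (supp z) (mlog z).
Proof. by move=> hz; rewrite point_of_coneE. Qed.

Lemma point_of_cone_default p0 p1 z : cone z ->
  point_of_cone p0 z = point_of_cone p1 z.
Proof. by move=> hz; rewrite !point_of_coneE. Qed.

Definition hcoord p : 'rV[R]_n :=
  \row_i (if i \in abI p then expR (- coord p 0 i) else 0).

Definition normz z : 'rV[R]_n := (\sum_i z 0 i)^-1 *: z.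

Definition simplex_coord p : 'rV[R]_n := normz (hcoord p).

Lemma cone_sum_gt0 z : cone z -> 0 < \sum_i z 0 i.
Proof.
move=> [z0 [i zi]]; rewrite (bigD1 i) //= ltr_pwDl //.
by apply: sumr_ge0 => j _; apply: z0.
Qed.

Lemma coneZ (a : R) z : 0 < a -> cone z -> cone (a *: z).
Proof.
move=> a0 [z0 [i zi]]; split=> [j|]; first by rewrite mxE mulr_ge0 // ltW.
by exists i; rewrite mxE mulr_gt0.
Qed.

Lemma cone_normz z : cone z -> cone (normz z).
Proof. by move=> hz; apply: coneZ => //; rewrite invr_gt0 cone_sum_gt0. Qed.

Lemma normzZ (a : R) z : 0 < a -> normz (a *: z) = normz z.
Proof.
move=> a0; rewrite /normz; under eq_bigr do rewrite mxE.
rewrite -mulr_sumr scalerA invfM mulrAC mulVf ?mul1r //.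
by rewrite gt_eqF.
Qed.

Lemma cone_hcoord p : cone (hcoord p).
Proof.
split=> [i|]; first by rewrite mxE; case: ifP => // _; apply: expR_ge0.
by have /finset.set0Pn[i iI] := abI_neq0 p; exists i; rewrite mxE iI expR_gt0.
Qed.

Lemma cone_simplex p : cone (simplex_coord p).
Proof. exact/cone_normz/cone_hcoord. Qed.

Lemma simplex_coord_sum p : \sum_i simplex_coord p 0 i = 1.
Proof.
under eq_bigr do rewrite mxE.
by rewrite -mulr_sumr mulVf // gt_eqF // cone_sum_gt0 //; apply: cone_hcoord.
Qed.

Lemma suppZ (a : R) z : 0 < a -> supp (a *: z) = supp z.
Proof. by move=> a0; apply/setP => i; rewrite !finset.inE mxE pmulr_rgt0. Qed.

Lemma supp_hcoord p : supp (hcoord p) = abI p.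
Proof.
apply/setP => i; rewrite !finset.inE mxE; case: ifP; rewrite ?ltxx //.
by rewrite expR_gt0.
Qed.

(** Scaling by a shifts every - ln (z_i) by the constant - ln a, which vanishes in A_I. *)
Lemma point_of_coneZ p0 (a : R) z : 0 < a -> cone z ->
  point_of_cone p0 (a *: z) = point_of_cone p0 z.
Proof.
move=> a0 hz; apply: abar_eq; first by rewrite !abI_point ?suppZ //; exact: coneZ.
rewrite !coord_point ?suppZ //; last exact: coneZ.
apply: (@normI_shift _ _ _ (- ln a)); first exact: supp_neq0.
by move=> i; rewrite finset.inE !mxE => zi; rewrite lnM // opprD addrC.
Qed.

Lemma point_of_hcoord p0 p : point_of_cone p0 (hcoord p) = p.
Proof.
have hp := cone_hcoord p.
apply: abar_eq; first by rewrite abI_point // supp_hcoord.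
rewrite coord_point // supp_hcoord -[RHS]normI_coord.
apply: (@normI_shift _ _ _ 0); first exact: abI_neq0.
by move=> i iI; rewrite !mxE iI expRK opprK addr0.
Qed.

Lemma simplex_coordK p0 p : point_of_cone p0 (simplex_coord p) = p.
Proof.
rewrite point_of_coneZ ?point_of_hcoord //; last exact: cone_hcoord.
by rewrite invr_gt0 cone_sum_gt0 //; apply: cone_hcoord.
Qed.

Lemma Aset_normI p : Aset p -> normI finset.setT (coord p) = coord p.
Proof. by move=> <-; rewrite normI_coord. Qed.

(* The set Gamma^I_U in homogeneous coordinates: adding an element of Delta_I
   leaves the coordinates in I unchanged and decreases exp (- x_j) for j outside I,
   and applying s_J sets the coordinates outside J to zero. *)
Definition star_cond I (U : set (Abar0 R n)) z :=
  exists2 u, U u & exists2 c : R, 0 < c &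
    (forall i, i \in I -> z 0 i = c * expR (- coord u 0 i)) /\
    (forall j, z 0 j <= c * expR (- coord u 0 j)).

Lemma star_condZ I U (a : R) z : 0 < a -> star_cond I U z -> star_cond I U (a *: z).
Proof.
move=> a0 [u Uu [c c0 [h1 h2]]]; exists u => //; exists (a * c); first exact: mulr_gt0.
split=> [i iI|j]; rewrite mxE -mulrA; first by rewrite h1.
by rewrite ler_pM2l.
Qed.

Lemma GammaP p0 I U z : I != finset.set0 -> U `<=` @Aset R n -> cone z ->
  Gamma I U (point_of_cone p0 z) <-> star_cond I U z.
Proof.
move=> I0 UA hz; have s0 := supp_neq0 hz; rewrite /Gamma /=; split.
  move=> H.
  (* Both clauses of [Gamma] reduce to one statement: the part lying in A is the case where J is the
     full set, s_J being the identity there. *)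
  have [a [Ua IJ e]] : exists a, [/\ UDelta I U a, I \subset supp z &
      normI (supp z) a = normI (supp z) (mlog z)].
    case: H => [[Ap Up]|[J [IJ _ eJ [a Ua e]]]].
      exists (Defs.coord (point_of_cone p0 z)); split => //.
        by rewrite -(abI_point p0 hz) Ap finset.subsetT.
      by rewrite -{1}(abI_point p0 hz) normI_coord coord_point.
    exists a; split=> //; first by rewrite -(abI_point p0 hz) eJ.
    by rewrite -(coord_point p0 hz) e -eJ abI_point.
  have [c1 h1] := normI_eqP e.
  case: Ua => u Uu [t [t0 tI ea]].
  (* [c2] is the mean of t, subtracted by the normalization; it is absorbed in the scale of the
     homogeneous coordinates. *)
  have [c2 h2] : exists c2, forall j, a 0 j = coord u 0 j + t 0 j - c2.
    eexists => j; rewrite ea !mxE finset.inE; rewrite addrA; reflexivity.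
  exists u => //; exists (expR (c1 + c2)); first exact: expR_gt0.
  have key j : j \in supp z -> z 0 j = expR (c1 + c2) * expR (- coord u 0 j) * expR (- t 0 j).
    move=> jz; have := h1 j jz; rewrite h2 mxE => hh.
    have zj : z 0 j \is Num.pos by rewrite posrE; move: jz; rewrite finset.inE.
    rewrite -(lnK zj) -!expRD; congr expR; lra.
  split=> [i iI|j].
    by rewrite key ?tI ?oppr0 ?expR0 ?mulr1 //; apply: (fintype.subsetP IJ).
  case: (boolP (j \in supp z)) => jz.
    rewrite key // ler_piMr //; first by rewrite mulr_ge0 // expR_ge0.
    by rewrite -expR0 ler_expR oppr_le0.
  apply: le_trans (_ : 0 <= _); last by rewrite mulr_ge0 // expR_ge0.
  by move: jz; rewrite finset.inE -leNgt.
case=> u Uu [c c0 [h1 h2]].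
have IJ : I \subset supp z.
  by apply/fintype.subsetP => i iI; rewrite finset.inE h1 // mulr_gt0 // expR_gt0.
(* On the support, t_j is forced by z_j = c exp (- u_j) exp (- t_j): it is nonnegative by [h2] and
   zero on I by [h1]. Off the support s_J forgets t_j. *)
pose t : 'rV[R]_n := \row_j (if j \in supp z then mlog z 0 j + ln c - coord u 0 j else 0).
have Ut : UDelta I U (coord u + normI finset.setT t).
  exists u => //; exists t; split=> // j.
    rewrite mxE; case: ifP => // jz; rewrite mxE.
    have zj : 0 < z 0 j by move: jz; rewrite finset.inE.
    have := h2 j; rewrite -ler_ln ?posrE ?mulr_gt0 ?expR_gt0 //.
    rewrite lnM ?posrE ?expR_gt0 // expRK; lra.
  move=> jI; rewrite mxE (fintype.subsetP IJ _ jI) mxE h1 //.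
  rewrite lnM ?posrE ?expR_gt0 // expRK; lra.
have eN : normI (supp z) (coord u + normI finset.setT t) = normI (supp z) (mlog z).
  apply: (@normI_shift _ _ _ (ln c - (\sum_(j in finset.setT) t 0 j) / 
    #|[set: 'I_n]%SET|%:R)) => //.
  move=> j jz; rewrite !mxE finset.inE jz.
  by ring.
case: (eqVneq (supp z) finset.setT) => eJ; [left|right].
  split; first by rewrite /Aset /= abI_point.
  rewrite coord_point // -eN eJ.
  have T0 : [set: 'I_n]%SET != finset.set0 by rewrite -eJ.
  (* The sum is already normalized, so [normI] over the full set fixes it. *)
  have eT : coord u + normI finset.setT t = coord (mkpt (coord u + t) T0).
    apply/rowP => j; rewrite !mxE finset.inE; under [in RHS]eq_bigr do rewrite mxE.
    by rewrite big_split /= -{3}(UA _ Uu) coord_sum; ring.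
  by rewrite eT (@Aset_normI (mkpt _ T0) erefl) -eT.
exists (supp z); split => //.
- by rewrite properT.
- by rewrite abI_point.
by exists (coord u + normI finset.setT t) => //; rewrite coord_point // eN.
Qed.

End Coordinates.

(** * Continuity of the map from the cone to the apartment *)

Section ConeTopology.
Variables (R : realType) (n : nat).
Implicit Types (I J : {set 'I_n}) (x y z : 'rV[R]_n) (p q : Abar R n).

Lemma cvg_row (T : Type) (F : set_system T) {FF : Filter F}
  (f : T -> 'rV[R]_n) (l : 'rV[R]_n) :
  (forall i, (fun t => f t 0 i) @ F --> l 0 i) -> f @ F --> l.
Proof.
move=> h B [P lP PB].
have : \forall t \near F, forall i, P 0 i (f t 0 i).
  by apply: filter_forall => i; apply: h; apply: lP.
by apply: filterS => t Pt; apply: PB => i j; rewrite ord1.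
Qed.

Lemma cvg_coord (T : Type) (F : set_system T) {FF : Filter F}
  (f : T -> 'rV[R]_n) (l : 'rV[R]_n) i :
  f @ F --> l -> (fun t => f t 0 i) @ F --> l 0 i.
Proof.
move=> fl; apply: (cvg_comp f (fun M : 'rV[R]_n => M 0 i) fl).
exact: coord_continuous.
Qed.

Arguments cvg_coord {T F FF f l} i _.

Lemma cvg_sumr (T : Type) (F : set_system T) {FF : Filter F} (J : Type) (r : seq J)
  (P : pred J) (f : J -> T -> R) (l : J -> R) :
  (forall j, P j -> f j @ F --> l j) ->
  (fun t => \sum_(j <- r | P j) f j t) @ F --> \sum_(j <- r | P j) l j.
Proof.
move=> h; elim: r => [|a r IH].
  by rewrite big_nil; under eq_fun do rewrite big_nil; apply: cvg_cst.
rewrite big_cons; under eq_fun do rewrite big_cons.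
by case: ifPn => // Pa; apply: cvgD => //; apply: h.
Qed.

Lemma normI_continuous I : continuous (@normI R n I).
Proof.
move=> x; apply: (@cvg_row _ (nbhs x) _ (@normI R n I)) => i.
under eq_fun do rewrite mxE; rewrite mxE.
case: ifPn => _; last exact: cvg_cst.
apply: cvgB; first exact: coord_continuous.
apply: cvgMr_tmp; apply: cvg_sumr => j _; exact: coord_continuous.
Qed.

Lemma cvg_mlog (T : Type) (F : set_system T) {FF : Filter F}
  (f : T -> 'rV[R]_n) (l : 'rV[R]_n) :
  (forall i, 0 < l 0 i) -> f @ F --> l -> (fun t => mlog (f t)) @ F --> mlog l.
Proof.
move=> l0 fl; apply: cvg_row => i; under eq_fun do rewrite mxE; rewrite mxE.
apply: cvgN; apply: (cvg_comp (fun t => f t 0 i) (@ln R) (cvg_coord i fl)).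
exact: continuous_ln.
Qed.

Lemma open_base (W : set (Abar R n)) : @Abar_base R n W -> open W.
Proof.
move=> bW; exists [set W]; last by rewrite bigcup_set1.
by move=> _ ->; apply: (@finI_from1 _ _ (@Abar_base R n) id).
Qed.

(** Every neighbourhood of p contains a finite intersection of generating sets around p, so these
    can be tested one by one, without proving that they form a base. *)
Lemma cvg_base (F : set_system (Abar R n)) {FF : Filter F} p :
  (forall W, @Abar_base R n W -> W p -> F W) -> F --> p.
Proof.
move=> h B [C [[D DD <-] [E DE Ep] CB]].
apply: filterS CB _; have [X XD eX] := DD E DE.
apply: (@filterS _ _ _ E); first by move=> x Ex; exists E.
rewrite -eX; apply: filter_bigI => W WX; apply: h; first exact: set_mem (XD W WX).
by move: Ep; rewrite -eX; apply.
Qed.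

Lemma openA_coord (U : set (Abar0 R n)) p : openA U -> U p ->
  \forall x \near coord p, forall q, Aset q -> coord q = x -> U q.
Proof.
move=> [UA [O [oO eU]]] Up.
have : O (coord p) by move: Up; rewrite eU => -[].
move=> Op; apply: filterS (open_nbhs_nbhs (conj oO Op)).
by move=> x Ox q Aq eq; rewrite eU; split => //; rewrite /preimage /= eq.
Qed.

Lemma expR_mlog z i : 0 < z 0 i -> z 0 i = expR (- mlog z 0 i).
Proof. by move=> zi; rewrite mxE opprK lnK // posrE. Qed.

(** The scale c is exp (- s), where s is the mean of the - ln (w_i) removed by normalization. *)
Lemma mkpt_mlog (w : 'rV[R]_n) (T0 : [set: 'I_n]%SET != finset.set0) : (forall i, 0 < w 0 i) ->
  exists2 c : R, 0 < c & forall i, w 0 i = c * expR (- coord (mkpt (mlog w) T0) 0 i).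
Proof.
move=> w0; pose s := (\sum_(j in [set: 'I_n]%SET) mlog w 0 j) / #|[set: 'I_n]%SET|%:R.
exists (expR (- s)); first exact: expR_gt0.
move=> i; rewrite [coord _ 0 i]mxE finset.inE -/s -expRD expR_mlog //.
by congr expR; ring.
Qed.

(* Coordinates outside I only satisfy an inequality, so the witness can be moved
   along with z by taking z itself on I and max(w, z) outside I. *)
Lemma star_cond_near I (U : set (Abar0 R n)) z : openA U -> star_cond I U z ->
  \forall z' \near z, star_cond I U z'.
Proof.
move=> oU [u Uu [c c0 [h1 h2]]].
have Au : Aset u by case: oU => h _; apply: h.
pose w0 i := c * expR (- coord u 0 i).
have w00 i : 0 < w0 i by rewrite mulr_gt0 // expR_gt0.
pose w z' : 'rV[R]_n := \row_i (if i \in I then z' 0 i else Order.max (w0 i) (z' 0 i)).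
(* At z itself the moving witness is the given one, by [h1] on I and [h2] outside. Hence w stays
   positive near z and its point of A stays in the open set U. *)
have wz : w z = \row_i w0 i.
  apply/rowP => i; rewrite !mxE; case: ifPn => [/h1//|_].
  by apply/max_idPl; apply: h2.
have wcvg : w z' @[z' --> z] --> w z.
  apply: (@cvg_row _ (nbhs z) _ w) => i; under eq_fun do rewrite mxE; rewrite mxE.
  case: ifPn => _; first exact: coord_continuous.
  apply: (@continuous_max R _ (fun=> w0 i) (fun M : 'rV[R]_n => M 0 i)).
    exact: cst_continuous.
  exact: (@coord_continuous R 1 n 0 i z).
have wz0 i : 0 < w z 0 i by rewrite wz mxE.
have T0 : [set: 'I_n]%SET != finset.set0 by rewrite -Au abI_neq0.
have ucvg : normI [set: 'I_n]%SET (mlog (w z')) @[z' --> z] --> coord u.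
  have -> : coord u = normI [set: 'I_n]%SET (mlog (w z)).
    rewrite -(Aset_normI Au); apply: (@normI_shift _ _ _ _ _ (ln c)) => // i _.
    by rewrite wz !mxE lnM ?posrE ?expR_gt0 // expRK; ring.
  apply: (cvg_comp (fun z' => mlog (w z')) (@normI R n [set: 'I_n]%SET));
    last exact: normI_continuous.
  exact: (cvg_mlog wz0 wcvg).
have wpos : \forall z' \near z, forall i, 0 < w z' 0 i.
  by apply: (@filter_forall _ _ (fun i z' => 0 < w z' 0 i) (nbhs z)) => i;
    exact: (cvgr_gt _ (cvg_coord i wcvg) _ (wz0 i)).
apply: filterS2 wpos (ucvg _ (openA_coord oU Uu)) => z' w'0 Uz'.
pose u' := mkpt (mlog (w z')) T0.
exists u'; first exact: Uz'.
have [s s0 wE] := mkpt_mlog T0 w'0.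
exists s => //.
split=> [i iI|j]; rewrite -wE mxE ?iI //.
by case: ifP => // _; rewrite le_max lexx orbT.
Qed.

(** For an open subset of A all coordinates of z are positive and [ln] is continuous there; for a
    set Gamma, [GammaP] reduces the claim to [star_cond_near]. *)
Lemma point_of_cone_cvg p0 z : cone z ->
  point_of_cone p0 @ within (@cone R n) (nbhs z) --> (point_of_cone p0 z : Abar R n).
Proof.
move=> hz; apply: cvg_base => W [oW|[I [U [I0 _ oU _ ->]]]] Wz.
  have Az : Aset (point_of_cone p0 z) by case: oW => h _; apply: h.
  have z0 i : 0 < z 0 i.
    have : i \in supp z by rewrite -(abI_point p0 hz) Az finset.inE.
    by rewrite finset.inE.
  have zpos : \forall z' \near z, forall i, 0 < (z' : 'rV[R]_n) 0 i.
    by apply: (@filter_forall _ _ (fun i (z' : 'rV[R]_n) => 0 < z' 0 i) (nbhs z)) => i;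
    exact: (cvgr_gt _ (@coord_continuous _ _ _ 0 i z) _ (z0 i)).
  have h : normI [set: 'I_n]%SET (mlog z') @[z' --> z] --> coord (point_of_cone p0 z).
    have -> : coord (point_of_cone p0 z) = normI [set: 'I_n]%SET (mlog z).
      by rewrite coord_point // -(abI_point p0 hz) Az.
    apply: (cvg_comp (fun z' => mlog z') (@normI R n [set: 'I_n]%SET));
    last exact: normI_continuous.
    exact: (@cvg_mlog _ (nbhs z) _ id z z0 cvg_id).
  apply: filterS2 zpos (h _ (openA_coord oW Wz)) => z' z'0 h' cz'.
  have Az' : supp z' = [set: 'I_n]%SET by apply/setP => i; rewrite !finset.inE z'0.
  by apply: h'; rewrite /Aset /= ?abI_point ?coord_point // Az'.
have UA : U `<=` @Aset R n by case: oU.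
have := Wz; rewrite GammaP // => /(star_cond_near oU).
by apply: filterS => z' h cz'; apply/GammaP.
Qed.

End ConeTopology.

(** * Continuity of the simplex coordinates *)

Section ConeHomeo.
Variables (R : realType) (n : nat).
Implicit Types (I J : {set 'I_n}) (x y z : 'rV[R]_n) (p q : Abar R n).

Lemma normz_continuous z : cone z -> @normz R n w @[w --> z] --> normz z.
Proof.
move=> hz; apply: (@cvg_row _ _ _ (nbhs z) _ (@normz R n)) => i.
under eq_fun do rewrite mxE; rewrite mxE.
apply: cvgM; last exact: coord_continuous.
apply: cvgV; first by rewrite gt_eqF // cone_sum_gt0.
by apply: cvg_sumr => j _; exact: coord_continuous.
Qed.

Lemma cvg_expR_coord (T : Type) (F : set_system T) {FF : Filter F}
  (f : T -> 'rV[R]_n) (l : 'rV[R]_n) (c : R) i : f @ F --> l ->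
  c * expR (- f t 0 i) @[t --> F] --> c * expR (- l 0 i).
Proof.
move=> fl; apply: cvgMl_tmp.
have h : - f t 0 i @[t --> F] --> - l 0 i by apply: cvgN; apply: cvg_coord.
exact: (cvg_comp (fun t => - f t 0 i) (@expR R) h (@continuous_expR R _)).
Qed.

Lemma star_cond_coord I (U : set (Abar0 R n)) p (u : Abar0 R n) (c : R) : U u -> 0 < c ->
  (forall i, i \in I -> hcoord p 0 i = c * expR (- coord u 0 i)) ->
  (forall i, hcoord p 0 i <= c * expR (- coord u 0 i)) ->
  star_cond I U (simplex_coord p).
Proof.
move=> Uu c0 h1 h2; apply: star_condZ; last by exists u => //; exists c.
by rewrite invr_gt0 cone_sum_gt0 //; apply: cone_hcoord.
Qed.

(** No set Gamma is attached to the full index set; this case lets points of A be treated together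
    with boundary points. *)
Lemma star_condT (U : set (Abar0 R n)) p : U `<=` @Aset R n ->
  star_cond [set: 'I_n]%SET U (simplex_coord p) <-> U p.
Proof.
move=> UA; split=> [[u Uu [c c0 [h _]]]|Up].
  suff -> : p = u by [].
  rewrite -(simplex_coordK p p) -[RHS](point_of_hcoord p).
  have -> : simplex_coord p = c *: hcoord u.
    by apply/rowP => i; rewrite h // 2!mxE (UA _ Uu) finset.inE.
  by rewrite point_of_coneZ //; apply: cone_hcoord.
have e i : hcoord p 0 i = 1 * expR (- coord p 0 i).
  by rewrite mul1r mxE (UA _ Up) finset.inE.
by apply: (@star_cond_coord _ _ _ p 1) => // i; rewrite e.
Qed.

Lemma nbhs_star_cond I (U : set (Abar0 R n)) p :
  I != finset.set0 -> openA U -> boundedA U -> star_cond I U (simplex_coord p) ->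
  nbhs p [set q : Abar R n | star_cond I U (simplex_coord q)].
Proof.
move=> I0 oU bU h; have UA : U `<=` @Aset R n by case: oU.
have [IT|IT] := eqVneq I [set: 'I_n]%SET.
  apply: (@filterS _ _ _ (U : set (Abar R n))); last first.
    apply: open_nbhs_nbhs; split; first by apply: open_base; left.
    by apply/star_condT => //; rewrite -IT.
  by move=> q Uq; rewrite /= IT; apply/star_condT.
apply: (@filterS _ _ _ (Gamma I U : set (Abar R n))).
  move=> q; rewrite -{1}(simplex_coordK p q) GammaP //; exact: cone_simplex.
apply: open_nbhs_nbhs; split.
  by apply: open_base; right; exists I, U; split => //; rewrite properT.
rewrite -(simplex_coordK p p); apply/GammaP => //; exact: cone_simplex.
Qed.

(** Gamma^I_U is used as a neighbourhood of p, with U a small ball-like set in A. Its equalities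
    control the coordinates in I, and its inequalities keep the others small. *)
Lemma simplex_coord_continuous : continuous (@simplex_coord R n : Abar R n -> 'rV[R]_n).
Proof.
move=> p B Bp; have [e e0 eB] : exists2 e : R, 0 < e &
    forall z, ball (hcoord p) e z -> B (normz z).
  by have /nbhs_ballP[e e0 h] := normz_continuous (cone_hcoord p) Bp; exists e.
set I := abI p.
(* The zero coordinates of p are replaced by e / 2, giving a point [u0] of A around which U is
   built. A further error below e / 2 keeps them below e. *)
pose w : 'rV[R]_n := \row_i (if i \in I then hcoord p 0 i else e / 2).
have w0 i : 0 < w 0 i.
  rewrite mxE; case: ifPn => iI; last by rewrite divr_gt0.
  by rewrite mxE -/I iI expR_gt0.
have T0 : [set: 'I_n]%SET != finset.set0.
  apply: contraTneq (abI_neq0 p) => eT; apply/negPn; rewrite -finset.subset0 -eT.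
  exact: finset.subsetT.
have [c c0 wE] := mkpt_mlog T0 w0.
set u0 := mkpt (mlog w) T0 in wE.
(* The first bound gives closeness in homogeneous coordinates, the second makes U bounded. *)
pose O : set 'rV[R]_n := [set x | forall i,
  `|w 0 i - c * expR (- x 0 i)| < e / 2 /\ `|coord u0 0 i - x 0 i| < 1].
have Ou0 : nbhs (coord u0) O.
  apply: (@filter_forall _ _ (fun i x => `|w 0 i - c * expR (- x 0 i)| < e / 2 /\
    `|coord u0 0 i - x 0 i| < 1) (nbhs (coord u0))) => i.
  apply: filterI.
    have h : c * expR (- (x : 'rV[R]_n) 0 i) @[x --> coord u0] --> w 0 i.
      by rewrite wE; apply: (@cvg_expR_coord _ (nbhs (coord u0)) _ id _ c i); exact: cvg_id.
    by apply: (cvgr_dist_lt _ _ h); rewrite divr_gt0.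
  by apply: (cvgr_dist_lt _ _ (@coord_continuous R 1 n 0 i (coord u0))).
pose U : set (Abar0 R n) := @Aset R n `&` (@Defs.coord R n @^-1` O°).
have oU : openA U.
  by split; [move=> ? []|exists O°; split => //; exact: open_interior].
have bU : boundedA U.
  exists (1 + \sum_i `|coord u0 0 i|) => u [_ /interior_subset Ou] i.
  have [_ h] := Ou i.
  have -> : coord u 0 i = - (coord u0 0 i - coord u 0 i) + coord u0 0 i by ring.
  apply: le_trans (ler_normD _ _) _; rewrite normrN; apply: lerD; first exact: ltW.
  by rewrite (bigD1 i) //= lerDl; apply: sumr_ge0.
have sp : star_cond I U (simplex_coord p).
  apply: (@star_cond_coord _ _ _ u0 c) => //.
    by move=> i iI; rewrite -wE [RHS]mxE iI.
  move=> i; rewrite -wE [leRHS]mxE; case: ifPn => // iI.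
  by rewrite mxE -/I (negbTE iI) divr_ge0 // ltW.
apply: filterS (nbhs_star_cond (abI_neq0 p) oU bU sp) => q [u [_ /interior_subset Ou]].
move=> [d d0 [h1 h2]]; rewrite /preimage /=.
have cd : 0 < c / d by rewrite divr_gt0.
(* The witness for q has scale d while [u0] has scale c; as [normz] ignores scaling, q may be
   rescaled to compare with [hcoord p]. *)
have -> : simplex_coord q = normz ((c / d) *: simplex_coord q).
  rewrite normzZ // [in RHS]/simplex_coord normzZ //.
  by rewrite invr_gt0 cone_sum_gt0 //; apply: cone_hcoord.
apply: eB; split => // j i; rewrite ord1 /ball /= [X in _ - X]mxE.
have [/= Oi _] := Ou i.
have [iI|iI] := boolP (i \in I).
  rewrite h1 // mulrA divfK ?gt_eqF //.
  by move: Oi; rewrite mxE iI => /lt_trans; apply; lra.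
rewrite [hcoord p 0 i]mxE -/I (negbTE iI) sub0r normrN ger0_norm; last first.
  by apply: mulr_ge0; [exact: ltW|case: (cone_simplex q)].
apply: le_lt_trans (_ : c * expR (- coord u 0 i) < e).
  by rewrite -[c in leRHS](divfK (lt0r_neq0 d0)) -[leRHS]mulrA ler_pM2l.
move: Oi; rewrite mxE (negbTE iI) ltr_norml => /andP[]; lra.
Qed.

Lemma cvg_point_of_cone (T : Type) (F : set_system T) {FF : Filter F}
  (f : T -> 'rV[R]_n) p0 z :
  (forall t, cone (f t)) -> cone z -> f @ F --> z ->
  (fun t => point_of_cone p0 (f t) : Abar R n) @ F --> (point_of_cone p0 z : Abar R n).
Proof.
move=> cf cz fz B Bz; have h := @point_of_cone_cvg R n p0 z cz B Bz.
have h2 : F [set t | cone (f t) -> B (point_of_cone p0 (f t))] by exact: (fz _ h).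
apply: (@filterS _ F FF _ _ _ h2) => t; apply; exact: cf.
Qed.

End ConeHomeo.

(** * Compactness, contractibility, openness and density *)

Section Apartment.
Variables (R : realType) (n : nat).
Hypothesis n_gt0 : (0 < n)%N.
Implicit Types (I J : {set 'I_n}) (z : 'rV[R]_n) (p q : Abar R n).

Lemma setT_neq0 : [set: 'I_n]%SET != finset.set0.
Proof. by apply/finset.set0Pn; exists (Ordinal n_gt0); rewrite finset.inE. Qed.

Definition origin : Abar R n := mkpt 0 setT_neq0.

Lemma Abar_compact : compact [set: Abar R n].
Proof.
pose box : set 'rV[R]_n := [set z | forall i, `[(0 : R), 1]%classic (z ord0 i)].
pose S : set 'rV[R]_n := box `&` [set z | \sum_i z 0 i = 1].
have cS : compact S.
  apply: compact_closedI.
    exact: (@rV_compact R n (fun=> `[0, 1]%classic) (fun i => @segment_compact R 0 1)).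
  apply: (@closed_comp _ _ (fun z : 'rV[R]_n => \sum_i z 0 i) [set 1]); last exact: closed_eq.
  by move=> z _; apply: (@cvg_sumr R _ (nbhs z) _ _ _ _ (fun i (z : 'rV[R]_n) => z 0 i)) => i _;
    exact: coord_continuous.
have SC z : S z -> cone z.
  move=> [bz sz]; split=> [i|]; first by have := bz i; rewrite /= in_itv /= => /andP[].
  apply: contrapT => /forallNP h; have : \sum_i z 0 i <= 0.
    by apply: sumr_le0 => i _; rewrite leNgt; apply/negP/h.
  by rewrite sz ler10.
suff -> : [set: Abar R n] = (point_of_cone origin : 'rV[R]_n -> Abar R n) @` S.
  apply: continuous_compact => //; apply/subspace_continuousP => z Sz B Bz.
  have h := @point_of_cone_cvg R n origin z (SC _ Sz) B Bz.
  have h2 : nbhs z [set z' | cone z' -> B (point_of_cone origin z')] by exact: h.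
  by apply: (@filterS _ (nbhs z) _ _ _ _ h2) => z' + /SC; apply.
apply/seteqP; split=> // p _; exists (simplex_coord p); last exact: simplex_coordK.
have s1 := simplex_coord_sum p.
split=> // i; rewrite /= in_itv /=; have [h0 _] := cone_simplex p; rewrite h0 /=.
by rewrite -s1 (bigD1 i) //= lerDl; apply: sumr_ge0.
Qed.

Lemma cone_convex (a b : R) z1 z2 : 0 <= a -> 0 <= b -> 0 < a + b ->
  cone z1 -> cone z2 -> cone (a *: z1 + b *: z2).
Proof.
move=> a0 b0 ab [h1 [i hi]] [h2 [j hj]]; split=> [k|].
  by rewrite !mxE addr_ge0 // mulr_ge0.
have [ap|] := ltP 0 a.
  by exists i; rewrite !mxE ltr_pwDl ?mulr_gt0 // mulr_ge0.
move=> an; have bp : 0 < b by lra.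
by exists j; rewrite !mxE ltr_pwDr ?mulr_gt0 // mulr_ge0.
Qed.

Lemma cvg_segment (T : Type) (F : set_system T) {FF : Filter F}
  (s : T -> R) (f : T -> 'rV[R]_n) (s0 : R) (z w : 'rV[R]_n) :
  s @ F --> s0 -> f @ F --> z ->
  (1 - s t) *: f t + s t *: w @[t --> F] --> (1 - s0) *: z + s0 *: w.
Proof.
move=> cs cf; apply: cvg_row => i.
under eq_fun do rewrite !mxE; rewrite !mxE.
apply: cvgD; apply: cvgM => //; [|exact: cvg_coord|exact: cvg_cst].
by apply: cvgB => //; exact: cvg_cst.
Qed.

Lemma Abar_contractible : contractible R (Abar R n).
Proof.
pose s (t : set_type (`[(0 : R), 1] : set R)) : R := set_val t.
have s01 t : 0 <= s t <= 1 by have := set_valP t; rewrite /= in_itv.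
(* Straight-line homotopy in the simplex towards its barycentre, the image of [origin]. *)
pose L (tp : set_type (`[(0 : R), 1] : set R) * Abar R n) : 'rV[R]_n :=
  (1 - s tp.1) *: simplex_coord tp.2 + s tp.1 *: simplex_coord origin.
have cL tp : cone (L tp).
  have /andP[s0 s1] := s01 tp.1.
  by apply: cone_convex; rewrite ?subr_ge0 ?subrK //; exact: cone_simplex.
exists origin, (fun tp => point_of_cone origin (L tp)); split.
- move=> tp; apply: cvg_point_of_cone => //; apply: cvg_segment.
    exact: (cvg_comp fst s cvg_fst (@initial_continuous _ _ set_val tp.1)).
  exact: (cvg_comp snd (@simplex_coord R n) cvg_snd (@simplex_coord_continuous R n tp.2)).
- by move=> t x; rewrite /L /s /= => ->; rewrite subr0 scale1r scale0r addr0 simplex_coordK.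
- by move=> t x; rewrite /L /s /= => ->; rewrite subrr scale1r scale0r add0r simplex_coordK.
Qed.

Lemma Aset_open : open (@Aset R n : set (Abar R n)).
Proof.
apply: open_base; left; split => //; exists setT; split; first exact: openT.
by rewrite preimage_setT setIT.
Qed.

Lemma Aset_dense : dense (@Aset R n : set (Abar R n)).
Proof.
move=> W [p Wp] oW.
(* For e > 0 all coordinates are positive, so f e represents a point of A. The absolute value keeps
   f e in the cone for every real e, as [cvg_point_of_cone] demands. *)
pose f (e : R) : 'rV[R]_n := simplex_coord p + `|e| *: const_mx 1.
have fE e i : f e 0 i = simplex_coord p 0 i + `|e| by rewrite !mxE mulr1.
have f0 : f 0 = simplex_coord p by rewrite /f normr0 scale0r addr0.
have [p0 [i pi]] := cone_simplex p.
have cf e : cone (f e).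
  split=> [j|]; first by rewrite fE addr_ge0.
  by exists i; rewrite fE ltr_pwDl.
have fc : f e @[e --> 0^'+] --> f 0.
  apply: cvg_row => j; under eq_fun do rewrite fE; rewrite fE.
  apply: cvgD; first exact: cvg_cst.
  apply: cvg_at_right_filter; exact: norm_continuous.
have := @cvg_point_of_cone R n _ _ _ _ p _ cf (cf 0) fc W.
rewrite f0 simplex_coordK => /(_ _ (open_nbhs_nbhs (conj oW Wp))) h.
have hW : \forall e \near (0 : R)^'+, W (point_of_cone p (f e)) by exact: h.
have [e [We e0]] := @filter_ex _ _ (at_right_proper_filter 0) _ (filterI hW (nbhs_right_gt (0 : R))).
exists (point_of_cone p (f e)); split => //.
rewrite /Aset /= abI_point //; apply/setP => j.
by rewrite !finset.inE fE ltr_wpDl // normr_gt0 gt_eqF.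
Qed.

End Apartment.

(** * Monomial matrices and valuations *)

Section Action.
Variables (R : realType) (K : fieldType) (v : K -> int) (n : nat).
Implicit Types (M : 'M[K]_n) (p : Abar R n).

Definition monomial M (s : 'S_n) := forall j k, (M j k != 0) = (k == s j).

Lemma col_of_monomial M s j : monomial M s -> col_of M j = s j.
Proof.
move=> hM; rewrite /col_of; case: pickP => [k|/(_ (s j))]; first by rewrite hM => /eqP.
by rewrite hM eqxx.
Qed.

(** Under - ln, the factor exp (v (M_j,s(j))) becomes the translation by - v (M_j,s(j)); the
    normalizing factor of [simplex_coord] only adds a constant. *)
Lemma nu_mx_monomial M (s : 'S_n) p : monomial M s ->
  nu_mx v M p = point_of_cone p
    (\row_j (simplex_coord p 0 (s j) * expR (v (M j (s j)))%:~R)).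
Proof.
move=> hM; set z := \row_j _.
have colE j : col_of M j = s j by apply: col_of_monomial.
pose a := (\sum_i hcoord p 0 i)^-1.
have a0 : 0 < a by rewrite invr_gt0 cone_sum_gt0 //; apply: cone_hcoord.
have zE j : z 0 j = a * hcoord p 0 (s j) * expR (v (M j (s j)))%:~R by rewrite !mxE.
have I'E : finset.finset (fun j => col_of M j \in abI p) = supp z.
  apply/setP => j; rewrite !finset.inE colE zE pmulr_lgt0 ?expR_gt0 // pmulr_rgt0 //.
  by rewrite mxE; case: ifP; rewrite ?ltxx ?expR_gt0.
have cz : cone z.
  split=> [j|].
    by rewrite zE !mulr_ge0 ?expR_ge0 ?(ltW a0) //; case: (cone_hcoord p).
  have [_ [i hi]] := cone_hcoord p; exists ((s^-1)%g i).
  by rewrite zE permKV !mulr_gt0 ?expR_gt0.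
rewrite /nu_mx I'E; set y := \row_j _.
have -> : normI (supp z) y = normI (supp z) (mlog z).
  apply: (@normI_shift _ _ _ _ _ (ln a)); first exact: supp_neq0.
  move=> j; rewrite -I'E finset.inE colE => jI.
  rewrite [RHS]addrC !mxE colE -/a jI lnM ?posrE ?mulr_gt0 ?expR_gt0 //.
  by rewrite lnM ?posrE ?expR_gt0 // !expRK; ring.
by rewrite (insubT (@abar_ok R n) (normI_ok (mlog z) (supp_neq0 cz))) point_of_coneE.
Qed.

(** The common shift c rescales the homogeneous coordinates by exp c. *)
Lemma nu_mx_eq M1 M2 (s : 'S_n) (c : int) p : monomial M1 s -> monomial M2 s ->
  (forall j, v (M1 j (s j)) = v (M2 j (s j)) + c) -> nu_mx v M1 p = nu_mx v M2 p.
Proof.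
move=> h1 h2 vE; rewrite (nu_mx_monomial p h1) (nu_mx_monomial p h2).
set z := \row_j (_ * expR (v (M2 _ _))%:~R).
have -> : \row_j (simplex_coord p 0 (s j) * expR (v (M1 j (s j)))%:~R) =
    expR c%:~R *: z.
  by apply/rowP => j; rewrite !mxE vE intrD expRD; ring.
apply: point_of_coneZ; first exact: expR_gt0.
have [h0 [i hi]] := cone_simplex p; split=> [j|].
  by rewrite mxE mulr_ge0 ?expR_ge0.
by exists ((s^-1)%g i); rewrite mxE permKV mulr_gt0 ?expR_gt0.
Qed.

Lemma nu_mx_continuous M (s : 'S_n) : monomial M s -> continuous (@nu_mx R K v n M).
Proof.
move=> hM p.
pose f q : 'rV[R]_n := \row_j (simplex_coord q 0 (s j) * expR (v (M j (s j)))%:~R).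
have cf q : cone (f q).
  have [h0 [i hi]] := cone_simplex q; split=> [j|].
    by rewrite mxE mulr_ge0 ?expR_ge0.
  by exists ((s^-1)%g i); rewrite mxE permKV mulr_gt0 ?expR_gt0.
have e : @nu_mx R K v n M = (fun q => point_of_cone p (f q)).
  by apply/funext => q; rewrite (nu_mx_monomial q hM); apply: point_of_cone_default; exact: cf.
rewrite e; apply: (@cvg_point_of_cone R n _ (nbhs p) _ f) => //.
apply: (@cvg_row _ _ _ (nbhs p) _ f) => i.
under eq_fun do rewrite mxE; rewrite mxE.
apply: cvgMr_tmp; apply: (@cvg_coord _ _ _ (nbhs p)).
exact: simplex_coord_continuous.
Qed.

Hypothesis hv : nonarch_local_field v.

Lemma valM (x y : K) : x != 0 -> y != 0 -> v (x * y) = v x + v y.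
Proof. by case: hv => + _ _ _ _; apply. Qed.

Lemma valN (x : K) : v (- x) = v x.
Proof.
have n0 : (1 : K) != 0 := oner_neq0 _.
have v1 : v 1 = 0 by have := valM n0 n0; rewrite mulr1; lia.
have m0 : (- 1 : K) != 0 by rewrite oppr_eq0.
have vm1 : v (- 1) = 0 by have := valM m0 m0; rewrite mulrNN mulr1 v1; lia.
have [->|x0] := eqVneq x 0; first by rewrite oppr0.
by rewrite -mulN1r valM // vm1 add0r.
Qed.

(** The + 1 makes v (y - x) > v x, and the ultrametric inequality, applied to y = x + (y - x) and to
    x = y - (y - x), gives both bounds. *)
Lemma val_ball (x y : K) : x != 0 -> vclose v (v x + 1) y x -> y != 0 /\ v y = v x.
Proof.
case: hv => _ vD _ _ _ x0 [/subr0_eq -> //|h].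
have y0 : y != 0 by apply: contraTneq h => ->; rewrite sub0r valN; lia.
split=> //; have [e|d0] := eqVneq (y - x) 0; first by rewrite (subr0_eq e).
have e1 : x + (y - x) = y by ring.
have e2 : y + - (y - x) = x by ring.
have nd0 : - (y - x) != 0 by rewrite oppr_eq0.
have h1 := vD _ _ x0 d0; rewrite e1 in h1.
have h2 := vD _ _ y0 nd0; rewrite e2 valN in h2.
by have := h1 y0; have := h2 x0; rewrite !ge_min; lia.
Qed.

Lemma nbhs_val (x : Kv v) : (x : K) != 0 ->
  nbhs x [set y : Kv v | (y : K) != 0 /\ v y = v x].
Proof.
move=> x0; set A := mkset _.
suff o : Kv_open A by exact: (@open_nbhs_nbhs (Kv v) x A (conj o (conj x0 erefl))).
move=> y [y0 vy].
exists (v y + 1) => z /(val_ball y0)[z0 vz]; split => //.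
by rewrite vz.
Qed.

(* Matrices inducing the same map as M0: entrywise the same valuations, up to a
   common shift coming from the scalars. *)
Definition same_val (M0 M : 'M[K]_n) := exists c : int,
  forall j k, M0 j k != 0 -> M j k != 0 /\ v (M j k) = v (M0 j k) + c.

Lemma same_valZ M0 M (a : K) : a != 0 -> same_val M0 M -> same_val M0 (a *: M).
Proof.
move=> a0 [c h]; exists (c + v a) => j k /h[Mjk vM].
by rewrite mxE mulf_neq0 // valM // vM addrC addrA.
Qed.

Lemma same_val_open (M0 : 'M[K]_n) :
  open [set A : GLn v n | same_val M0 (mxK (set_val A))].
Proof.
rewrite openE => A [c h].
have : nbhs (set_val A) [set B : 'M[Kv v]_n | same_val M0 (mxK B)].
  (* A box neighbourhood: only the entries where [M0] is nonzero are constrained. *)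
  exists (fun i j => if M0 i j != 0
     then [set y : Kv v | (y : K) != 0 /\ v y = v (mxK (set_val A) i j)] else setT).
    move=> i j; case: ifPn => hij; last exact: filterT.
    by apply: nbhs_val; have [] := h i j hij.
  move=> B hB; exists c => i j hij; have := hB i j; rewrite hij => -[B0 vB].
  by split=> //; rewrite [LHS]vB; have [] := h i j hij.
exact: (@initial_continuous _ _ set_val A).
Qed.

End Action.

(** * Local constancy of the action on N *)

Section Normalizer.
Local Open Scope quotient_scope.
Variables (K : fieldType) (v : K -> int) (n : nat).

Lemma eq_PGLn (A B : GLn v n) : \pi_(PGLn v n) A = \pi_(PGLn v n) B ->
  exists2 c : K, c != 0 & mxK (set_val B) = c *: mxK (set_val A).
Proof.
move=> e; have /eqmodP/asboolP[c [c0 cE]] :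
  \pi_({eq_quot @scal_rel K v n}) A = \pi_({eq_quot @scal_rel K v n}) B := e.
by exists c.
Qed.

(** The chosen representative is a nonzero scalar multiple of a diagonal matrix times a permutation
    matrix, so it has the same zero pattern. *)
Lemma Nmx_monomial (g : Nn v n) : exists s, monomial (Nmx g) s.
Proof.
have [M [Mg [d [s [d0 dE]]]]] := set_valP g.
have [c c0 cE] : exists2 c : K, c != 0 & Nmx g = c *: mxK (set_val M).
  by apply: eq_PGLn; rewrite Mg reprK.
exists s => j k; rewrite cE dE mxE mul_diag_mx !mxE !mulf_eq0 (negbTE c0) (negbTE (d0 j)) /=.
by rewrite [k == _]eq_sym; case: (s j == k); rewrite ?oner_eq0 ?eqxx.
Qed.

Hypothesis hv : nonarch_local_field v.

Lemma near_same_val (g0 : Nn v n) : \forall g \near g0, same_val v (Nmx g0) (Nmx g).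
Proof.
pose Q : set (PGLn v n) :=
  [set h | same_val v (Nmx g0) (mxK (set_val (generic_quotient.repr h)))].
have oQ : open Q.
  (* Since [same_val] is invariant under nonzero scalars, Q does not depend on representatives, and
     openness in the quotient is openness of this preimage. *)
  suff e : \pi_(PGLn v n) @^-1` Q = [set A : GLn v n | same_val v (Nmx g0) (mxK (set_val A))].
    by rewrite /open /= /quotient_open e; exact: same_val_open.
  apply/seteqP; split=> A /= hA.
    have [c c0 ->] : exists2 c : K, c != 0 & mxK (set_val A) =
        c *: mxK (set_val (generic_quotient.repr (\pi_(PGLn v n) A))).
      by apply: eq_PGLn; rewrite reprK.
    exact: same_valZ.
  have [c c0 e] : exists2 c : K, c != 0 &
      mxK (set_val (generic_quotient.repr (\pi_(PGLn v n) A))) = c *: mxK (set_val A).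
    by apply: eq_PGLn; rewrite reprK.
  by rewrite /Q /= e; exact: same_valZ.
have Qg : Q (set_val g0) by exists 0 => j k h; rewrite addr0.
exact: (@initial_continuous _ _ set_val g0 _ (open_nbhs_nbhs (conj oQ Qg))).
Qed.

Lemma near_nu (R : realType) (g0 : Nn v n) :
  \forall g \near g0, @nu R K v n g = nu g0.
Proof.
apply: filterS (near_same_val g0) => g [c h].
have [s hs] := Nmx_monomial g; have [s0 hs0] := Nmx_monomial g0.
(* Nonzero entries of [Nmx g0] stay nonzero in [Nmx g], and each row has only one, so the
   permutations agree. *)
have es : s = s0.
  apply/permP => j; have : Nmx g0 j (s0 j) != 0 by rewrite hs0.
  by move=> /h[]; rewrite hs => /eqP.
rewrite es in hs; apply/funext => p; apply: (@nu_mx_eq R K v n _ _ s0 c p hs hs0) => j.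
by have [|_ ->//] := h j (s0 j); rewrite hs0.
Qed.

(** Local constancy in g reduces joint continuity to that of the single map [nu g0]. *)
Lemma nu_continuous (R : realType) :
  continuous (fun gp : Nn v n * Abar R n => nu gp.1 gp.2).
Proof.
move=> [g0 p0] B /= Bn; have [s hs] := Nmx_monomial g0.
exists ([set g | @nu R K v n g = nu g0], [set p | B (nu g0 p)]); last first.
  by move=> [g p] /= [-> ].
split => /=; first exact: near_nu.
exact: (nu_mx_continuous hs Bn).
Qed.

End Normalizer.

Theorem theorem3p1 (R : realType) (K : fieldType) (v : K -> int) (n : nat) :
  nonarch_local_field v -> (0 < n)%N ->
  [/\ compact [set: Abar R n],
      contractible R (Abar R n),
      open (@Aset R n : set (Abar R n)),
      dense (@Aset R n : set (Abar R n))
    & continuous (fun gp : Nn v n * Abar R n => nu gp.1 gp.2)].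
Proof.
move=> hv n_gt0; split.
- exact: Abar_compact.
- exact: Abar_contractible.
- exact: Aset_open.
- exact: Aset_dense.
- exact: nu_continuous.
Qed.
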